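(* Let $F$ be a field and let $m(x)=x^3+ax^2+bx+c\in F[x]$ be irreducible. Let $T$ be the set of all matrices in $\mathcal{C}(m)$ with first row equal to $\begin{bmatrix}0&0&-c\end{bmatrix}$. Then every nonempty subset of $T$ is not core. When $F=\mathbb{F}_q$, we have $|T|=q^3-q^2$, and for each $1\leq s\leq q^3-q^2$, $\mathcal{C}(m)$ contains a non-core subset with $s$ elements.
   Context: $M_3(F)$ is the ring of $3\times 3$ matrices over $F$. $\mathcal{C}(m)$ is the set of all $A\in M_3(F)$ whose minimal polynomial is $m$. For polynomials in $M_3(F)[x]$ the indeterminate $x$ is central, and $f(x)=\sum_i \alpha_i x^i$ is evaluated at $A\in M_3(F)$ by right evaluation, $f(A)=\sum_i \alpha_i A^i$. For $S\subseteq M_3(F)$, the null ideal is $N(S)=\{f\in M_3(F)[x] : f(A)=0 \text{ for all } A\in S\}$. The set $S$ is called core if $N(S)$ is a two-sided ideal of $M_3(F)[x]$. *)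

(* Defs.v *)
From HB Require Import structures.
From mathcomp Require Import all_boot all_order all_algebra.
From mathcomp Require Import classical_sets cardinality.
Set Implicit Arguments.
Unset Strict Implicit.
Unset Printing Implicit Defensive.
Import GRing.Theory.
Local Open Scope classical_set_scope.
Local Open Scope ring_scope.

(* Since [f.[A]] follows the Horner scheme, it equals [\sum_i f`_i * A ^+ i]
   with the coefficients on the left of the powers of [A], also when the ring
   [R] is not commutative; ['X] is central in [{poly R}]. *)
Definition null_ideal (R : nzRingType) (S : set R) : set {poly R} :=
  [set f | forall A, S A -> f.[A] = 0].

Definition two_sided_ideal (R : nzRingType) (I : set R) : Prop :=
  [/\ I 0,
      forall x y, I x -> I y -> I (x - y),
      forall r x, I x -> I (r * x)
    & forall r x, I x -> I (x * r)].

Definition core (R : nzRingType) (S : set R) : Prop :=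
  two_sided_ideal (null_ideal S).

Definition minpoly_class (F : fieldType) (m : {poly F}) : set 'M[F]_3 :=
  [set A | mxminpoly A = m].

Definition first_row_class (F : fieldType) (m : {poly F}) (c : F) :
    set 'M[F]_3 :=
  [set A | minpoly_class m A /\ row 0 A = \row_(j < 3) [:: 0; 0; - c]`_j].

(* Main.v *)
(** Write [A] for a matrix with first row [(0, 0, -c)] and last row [(g, h, k)].
    Left multiplication by [E_00] sees only the first row, so [E_00 x + c E_02]
    annihilates every member of the class, whereas right multiplication of this
    polynomial by [E_00] gives [E_00 x], which annihilates no [A] because
    [c <> 0].  For the count, [h = 0] would make the middle diagonal entry an
    eigenvalue of [A], against irreducibility; when [h <> 0], comparing the
    characteristic polynomial with [m] determines the middle row uniquely from
    [(g, h, k)]. *)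
Require Import Defs.
From HB Require Import structures.
From mathcomp Require Import all_boot all_order all_algebra.
From mathcomp Require Import classical_sets cardinality.
From mathcomp Require Import functions ring.
Set Implicit Arguments.
Unset Strict Implicit.
Unset Printing Implicit Defensive.
Import GRing.Theory.
Local Open Scope classical_set_scope.
Local Open Scope card_scope.
Local Open Scope ring_scope.

(** The pair of [x] and [y] gets the number [f x * n + g y]; since [g y < n], Euclidean division by
    [n] recovers both coordinates. *)
Lemma card_eq_setX (T U : Type) (A : set T) (B : set U) (m n : nat) :
  A #= `I_m -> B #= `I_n -> A `*` B #= `I_(m * n).
Proof.
move=> /card_set_bijP[f [fA fI fS]] /card_set_bijP[g [gB gI gS]].
apply/card_set_bijP; exists (fun p => f p.1 * n + g p.2)%N; split.
- move=> [x y] [/= /fA /= ltf /gB /= ltg].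
  by rewrite (@leq_trans (f x * n + n)%N) ?ltn_add2l // -mulSnr leq_mul2r ltf orbT.
- move=> [x y] [x' y'] /set_mem[/= Ax By] /set_mem[/= Ax' By'] eqfg.
  have ltg := gB _ By; have ltg' := gB _ By'; rewrite /= in ltg ltg'.
  have n_gt0 : (0 < n)%N by apply: leq_trans ltg.
  have eqf : f x = f x'.
    by have := congr1 (divn^~ n) eqfg; rewrite /= !divnMDl // !divn_small // !addn0.
  have eqg : g y = g y'.
    by have := congr1 (modn^~ n) eqfg; rewrite /= !modnMDl !modn_small.
  by rewrite (fI _ _ (mem_set Ax) (mem_set Ax') eqf)
             (gI _ _ (mem_set By) (mem_set By') eqg).
- move=> i /= lti.
  have n_gt0 : (0 < n)%N by case: n lti {gB gI gS} => //; rewrite muln0.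
  have [|x Ax fx] := fS (i %/ n)%N; first by rewrite /= ltn_divLR.
  have [|y By gy] := gS (i %% n)%N; first by rewrite /= ltn_mod.
  by exists (x, y) => //=; rewrite fx gy -divn_eq.
Qed.

Lemma card_eq_setC1 (T : Type) (x : T) (n : nat) :
  [set: T] #= `I_n -> [set~ x] #= `I_n.-1.
Proof.
move=> cT.
have /finite_setP[p cp] : finite_set [set~ x].
  by apply: (@sub_finite_set _ _ setT) => //; apply/finite_setP; exists n.
(* Putting [x] back into its complement of size [p] gives [p.+1 = n], hence [p = n.-1]. *)
suff /card_eq_II <- : `I_p.+1 #= `I_n by [].
apply: card_eq_trans cT; rewrite card_eq_sym; apply/eq_cardSP; exists x => //.
by rewrite setTD.
Qed.

Lemma char_poly3 (R : comNzRingType) (A : 'M[R]_3) :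
  char_poly A = 'X^3 + (- (A 0 0 + A 1 1 + A 2 2)) *: 'X^2
    + (A 0 0 * A 1 1 - A 0 1 * A 1 0 + (A 0 0 * A 2 2 - A 0 2 * A 2 0)
       + (A 1 1 * A 2 2 - A 1 2 * A 2 1)) *: 'X
    + (- (A 0 0 * (A 1 1 * A 2 2 - A 1 2 * A 2 1)
          - A 0 1 * (A 1 0 * A 2 2 - A 1 2 * A 2 0)
          + A 0 2 * (A 1 0 * A 2 1 - A 1 1 * A 2 0)))%:P.
Proof.
rewrite /char_poly (expand_det_row _ 0) !big_ord_recl big_ord0 /cofactor.
rewrite !(expand_det_row _ 0) !big_ord_recl !big_ord0 /cofactor !det_mx11 !mxE /=.
(* Indexing the entries by natural numbers lets the ordinals left by the nested cofactor expansions
   compute to numerals, so that [ring] identifies equal entries. *)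
pose B i j := A (inord i) (inord j).
have AE i j : A i j = B i j by rewrite /B !inord_val.
rewrite !AE /= /bump /= -!mul_polyC.
move: (B) => {AE}B /=; ring.
Qed.

Lemma monic_cubic_inj (R : nzRingType) (a b c a' b' c' : R) :
  'X^3 + a *: 'X^2 + b *: 'X + c%:P = 'X^3 + a' *: 'X^2 + b' *: 'X + c'%:P ->
  [/\ a = a', b = b' & c = c'].
Proof.
move=> /polyP E; move: (E 2%N) (E 1%N) (E 0%N).
by rewrite !(coefD, coefZ, coefXn, coefX, coefC) /= !(mulr0, mulr1, addr0, add0r).
Qed.

Lemma size_monic_cubic (R : nzRingType) (a b c : R) :
  size ('X^3 + a *: 'X^2 + b *: 'X + c%:P) = 4%N.
Proof.
rewrite -!addrA size_polyDl size_polyXn //.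
rewrite -mul_polyC (leq_ltn_trans (size_polyD _ _)) // gtn_max.
rewrite (leq_ltn_trans (size_polyMleq _ _)) /=; last first.
  by rewrite size_polyXn addn3 /= ltnS ltnS size_polyC; case: (_ != 0).
rewrite (leq_ltn_trans (size_polyD _ _)) // gtn_max.
rewrite (leq_ltn_trans (size_scale_leq _ _)) ?size_polyX //=.
by rewrite (leq_ltn_trans (size_polyC_leq1 _)).
Qed.

Lemma monic_monic_cubic (R : nzRingType) (a b c : R) :
  'X^3 + a *: 'X^2 + b *: 'X + c%:P \is monic.
Proof.
rewrite monicE lead_coefE size_monic_cubic.
by rewrite !(coefD, coefZ, coefXn, coefX, coefC) /= !(mulr0, addr0).
Qed.

(** The minimal polynomial divides the characteristic one, of degree [n.+1]. If it is [m], both are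
    monic of the same degree; conversely, a nonconstant monic divisor of the irreducible [m] is [m]
    itself. *)
Lemma mxminpoly_irreducibleP (F : fieldType) (n : nat) (A : 'M[F]_n.+1)
    (m : {poly F}) :
    irreducible_poly m -> m \is monic -> size m = n.+2 ->
  mxminpoly A = m <-> char_poly A = m.
Proof.
move=> [m_gt1 m_irr] m_monic size_m; split=> [Am|chA].
  have m_dvd : m %| char_poly A by rewrite -Am mxminpoly_dvd_char.
  apply/eqP; rewrite eq_sym -eqp_monic ?char_poly_monic // -dvdp_size_eqp //.
  by rewrite size_char_poly size_m.
apply/eqP; rewrite -eqp_monic ?mxminpoly_monic //; apply: m_irr.
  by rewrite size_mxminpoly eqSS -lt0n mxminpoly_nonconstant.
by rewrite -chA mxminpoly_dvd_char.
Qed.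

Lemma irreducible_noroot (F : fieldType) (m : {poly F}) (x : F) :
  irreducible_poly m -> (2 < size m)%N -> ~~ root m x.
Proof.
move=> [_ m_irr] m_gt2; apply/negP; rewrite root_factor_theorem => /m_irr.
rewrite size_XsubC => /(_ isT) /eqp_size; rewrite size_XsubC => m_eq2.
by rewrite -m_eq2 in m_gt2.
Qed.

Lemma ord3_ind (P : 'I_3 -> Prop) : P 0 -> P 1 -> P 2 -> forall i, P i.
Proof.
move=> P0 P1 P2 [[|[|[|//]]] lti]; [move: P0|move: P1|move: P2];
  by congr P; apply/val_inj.
Qed.

Lemma row3P (R : nzRingType) (A : 'M[R]_3) (i : 'I_3) (x y z : R) :
  row i A = \row_j [:: x; y; z]`_j <-> [/\ A i 0 = x, A i 1 = y & A i 2 = z].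
Proof.
split=> [/rowP E|[Ax Ay Az]].
  by split; [have := E 0|have := E 1|have := E 2]; rewrite !mxE.
by apply/rowP; apply: ord3_ind; rewrite !mxE.
Qed.

Lemma mul_delta_mxE (R : nzRingType) (m n p : nat) (i : 'I_m) (k : 'I_n)
    (A : 'M[R]_(n, p)) (i' : 'I_m) (j : 'I_p) :
  (delta_mx i k *m A) i' j = A k j *+ (i' == i).
Proof.
rewrite mxE (bigD1 k) //= big1 => [|l l_neq_k].
  by rewrite mxE eqxx andbT addr0 mulr_natl.
by rewrite mxE (negPf l_neq_k) andbF mul0r.
Qed.

Section FirstRowClass.
Variables (F : fieldType) (a b c : F) (m : {poly F}).
Hypothesis Hm : m = 'X^3 + a *: 'X^2 + b *: 'X + c%:P.
Hypothesis m_irr : irreducible_poly m.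

Let size_m : size m = 4%N. Proof. by rewrite Hm size_monic_cubic. Qed.

Let m_noroot x : m.[x] != 0.
Proof. by have := irreducible_noroot x m_irr; rewrite size_m => /(_ isT). Qed.

Let c_neq0 : c != 0.
Proof. by have := m_noroot 0; rewrite Hm !hornerE /= !expr0n !mulr0 !add0r. Qed.

(** The last three equations compare the coefficients of the characteristic polynomial with [a], [b]
    and [c]. The constant one reads [c * (A 1 0 * A 2 1 - A 1 1 * A 2 0) = c], where [c], the
    nonzero value of [m] at 0, cancels. *)
Lemma first_row_classP (A : 'M[F]_3) :
  first_row_class m c A <->
  [/\ [/\ A 0 0 = 0, A 0 1 = 0 & A 0 2 = - c],
      A 1 1 = - a - A 2 2,
      A 1 2 * A 2 1 = c * A 2 0 + A 1 1 * A 2 2 - b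
    & A 1 0 * A 2 1 = 1 + A 1 1 * A 2 0].
Proof.
have minE : mxminpoly A = m <-> char_poly A = m.
  by apply: mxminpoly_irreducibleP; rewrite // Hm monic_monic_cubic.
rewrite /first_row_class /minpoly_class /= minE row3P char_poly3 Hm.
split=> [[+ [A00 A01 A02]]|[[-> -> ->] A11 A12 A10]].
  rewrite A00 A01 A02 => /monic_cubic_inj[<- <- Ec]; split=> //; try by ring.
  apply/eqP; rewrite -subr_eq; apply/eqP/(mulfI c_neq0).
  by rewrite mulr1 -[RHS]Ec; ring.
split=> //; congr (_ + _ *: _ + _ *: _ + _%:P).
- by rewrite A11; ring.
- by ring: A12.
- by ring: A10.
Qed.

Lemma first_row_class_neq0 (A : 'M[F]_3) : first_row_class m c A -> A 2 1 != 0.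
Proof.
move=> /first_row_classP[_ A11 A12 A10]; apply/eqP => A21.
move: A12 A10; rewrite A21 !mulr0 => A12 A10.
(* Substituting for [a] and [b] turns [m.[A 1 1]] into [c * (1 + A 1 1 * A 2 0)], whose second
   factor is zero by [A10]. *)
have /eqP[] := m_noroot (A 1 1); rewrite Hm !hornerE /=.
have -> : a = - A 1 1 - A 2 2 by rewrite A11; ring.
have -> : b = c * A 2 0 + A 1 1 * A 2 2.
  by apply/esym/eqP; rewrite -subr_eq0 -A12.
by rewrite -[RHS](mulr0 c) A10; ring.
Qed.

Lemma first_row_class_not_core (S : set 'M[F]_3) :
  S `<=` first_row_class m c -> S !=set0 -> ~ core S.
Proof.
move=> subS [A SA] [_ _ _ mulr_closed].
pose f := (delta_mx 0 0)%:P * 'X + (c *: delta_mx 0 2)%:P : {poly 'M[F]_3}.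
have f_null : null_ideal S f.
  move=> B /subS[_ /rowP rowB]; rewrite hornerMXaddC hornerC.
  rewrite -[_ * B]/(_ *m B); apply/matrixP => i j.
  rewrite mxE mul_delta_mxE; have := rowB j; rewrite !mxE => ->.
  case: (i == 0); last by rewrite mulr0 addr0.
  by elim/ord3_ind: j; rewrite /= ?mulr0 ?mulr1 ?addr0 ?addNr.
have := mulr_closed (delta_mx 0 0)%:P f f_null A SA.
(* Moving the constant past the central ['X] leaves [E_00 E_00 x + c E_02 E_00]. The second product
   is zero, and the first takes at [A] the value [E_00 A], whose entry in position (0, 2) is
   [- c]. *)
rewrite mulrDl -mulrA -commr_polyX mulrA -!polyCM hornerMXaddC hornerC.
rewrite -scalerAl -![delta_mx _ _ * delta_mx _ _]/(_ *m _).
rewrite mul_delta_mx mul_delta_mx_0 // scaler0 addr0 => /matrixP /(_ 0 2).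
have /subS[_ /row3P[_ _ A02]] := SA.
rewrite -[_ * A]/(_ *m A) mul_delta_mxE A02 mxE => /eqP.
by rewrite oppr_eq0 (negPf c_neq0).
Qed.

Lemma card_first_row_class :
  first_row_class m c #= [set: F] `*` ([set~ 0 : F] `*` [set: F]).
Proof.
pose last_row (A : 'M[F]_3) := (A 2 0, (A 2 1, A 2 2)).
have -> : [set: F] `*` ([set~ 0 : F] `*` [set: F])
    = [set last_row A | A in first_row_class m c].
  apply/seteqP; split=> [[g [h k]] [_ [/= /eqP h_neq0 _]]|_ [A TA <-]]; last first.
    by split=> //; split=> //; apply/eqP/first_row_class_neq0.
  (* The trace forces the middle diagonal entry [e]; the other two entries of the middle row solve
     the remaining equations of [first_row_classP], each divided by [h]. *)
  pose e := - a - k.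
  pose s := [:: [:: 0; 0; - c]; [:: (1 + e * g) / h; e; (c * g + e * k - b) / h];
                [:: g; h; k]].
  exists (\matrix_(i, j) (nth [::] s i)`_j); last by rewrite /last_row !mxE.
  by apply/first_row_classP; rewrite !mxE /= !divfK.
rewrite card_eq_sym; apply: inj_card_eq => A B /set_mem TA /set_mem TB [E0 E1 E2].
have A21 := first_row_class_neq0 TA.
move/first_row_classP: TB; rewrite -E0 -E1 -E2.
move/first_row_classP: TA => [[A00 A01 A02] A11 A12 A10].
move=> [[B00 B01 B02] B11 B12 B10].
have E11 : A 1 1 = B 1 1 by rewrite A11 B11.
have E12 : A 1 2 = B 1 2 by apply: (mulIf A21); rewrite A12 B12 E11.
have E10 : A 1 0 = B 1 0 by apply: (mulIf A21); rewrite A10 B10 E11.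
by apply/matrixP; do 2![apply: ord3_ind];
   rewrite ?(A00, A01, A02, B00, B01, B02).
Qed.

End FirstRowClass.

Theorem proposition2p10 (F : fieldType) (a b c : F) (m : {poly F})
    (Hm : m = 'X^3 + a *: 'X^2 + b *: 'X + c%:P)
    (m_irr : irreducible_poly m) :
  (forall S : set 'M[F]_3,
     S `<=` first_row_class m c -> S !=set0 -> ~ core S) /\
  (forall q : nat, [set: F] #= `I_q ->
     first_row_class m c #= `I_(q ^ 3 - q ^ 2)%N /\
     (forall s : nat, (1 <= s <= q ^ 3 - q ^ 2)%N ->
        exists S : set 'M[F]_3,
          [/\ S `<=` minpoly_class m, S #= `I_s & ~ core S])).
Proof.
split=> [|q cardF]; first exact: first_row_class_not_core Hm m_irr.
have cardT : first_row_class m c #= `I_(q ^ 3 - q ^ 2)%N.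
  apply: card_eq_trans (card_first_row_class Hm m_irr) _.
  have -> : (q ^ 3 - q ^ 2 = q * (q.-1 * q))%N.
    by rewrite -subn1 mulnBl mul1n mulnBr -mulnn.
  by apply: card_eq_setX => //; apply: card_eq_setX => //; apply: card_eq_setC1.
split=> // s /andP[s_gt0 s_le].
have /card_set_bijP[g g_bij] := cardT.
(* [f] inverts the numbering [g] of the class; the default zero matrix only serves indices out of
   range. The required subset consists of the first [s] values of [f], and [0 < s] makes it
   nonempty. *)
have [f [fT f_inj _]] := ex_intro _ _ (bijpinv_bij (fun=> 0) g_bij).
have sub_s : `I_s `<=` `I_(q ^ 3 - q ^ 2) by move=> i /= /leq_trans; apply.
have subT : f @` `I_s `<=` first_row_class m c.
  by move=> _ [i /sub_s lt_i <-]; apply: fT.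
exists (f @` `I_s); split.
- by move=> A /subT[].
- apply: inj_card_eq => i j /set_mem lt_i /set_mem lt_j.
  by apply: f_inj; apply/mem_set/sub_s.
- by apply: (first_row_class_not_core Hm m_irr subT); exists (f 0%N), 0%N.
Qed.
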